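(* Let $\mathfrak{B}$ be a Bol algebra of dimension 3 with trilinear operation of Type III$^+$ whose canonical enveloping Lie algebra has dimension 4. Then $\mathfrak{B}$ is isotopic to one of the following Bol algebras with basis $e_1,e_2,e_3$, in each of which $(e_1,e_2,e_2)=-e_1$ (all operations on basis vectors not listed, and not following by skew-symmetry in the first two arguments, are zero): (i) $e_1\cdot e_2=-e_2$; (ii) $e_1\cdot e_2=-ze_3$, with $z\in\{0,1\}$.
   Context: A Bol algebra is a finite-dimensional real vector space $\mathfrak{B}$ with a bilinear operation $x\cdot y$ and a trilinear operation $(x,y,z)$ such that for all elements: $x\cdot x=0$; $(x,x,y)=0$; $(x,y,z)+(y,z,x)+(z,x,y)=0$; $(x,y,(z,\xi,\eta))=((x,y,z),\xi,\eta)+(z,(x,y,\xi),\eta)+(z,\xi,(x,y,\eta))$; $(x,y,z)\cdot\xi-(x,y,\xi)\cdot z+(z,\xi,x\cdot y)-(x,y,z\cdot\xi)+(x\cdot y)\cdot(z\cdot\xi)=0$. Type III$^+$: the trilinear operation is of Type III$^+$ if in some basis $e_1,e_2,e_3$ of $\mathfrak{B}$ it is given by $(e_1,e_2,e_2)=-e_1=-(e_2,e_1,e_2)$, all other $(e_i,e_j,e_k)$ being zero. Canonical enveloping Lie algebra: an enveloping pair of a Bol algebra $\mathfrak{B}$ consists of a finite-dimensional real Lie algebra $\mathfrak{G}$ containing $\mathfrak{B}$ as a vector subspace and a subalgebra $\mathfrak{h}$ with $\mathfrak{G}=\mathfrak{B}\oplus\mathfrak{h}$ (direct sum of vector spaces),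 $[[\mathfrak{B},\mathfrak{B}],\mathfrak{B}]\subset\mathfrak{B}$, $x\cdot y$ equal to the projection of $[x,y]$ onto $\mathfrak{B}$ parallel to $\mathfrak{h}$, and $(x,y,z)=[[x,y],z]$. It is canonical if $\mathfrak{B}$ generates $\mathfrak{G}$ as a Lie algebra and $\mathfrak{h}$ contains no nonzero ideal of $\mathfrak{G}$. Isotopic Bol algebras: let $\mathfrak{G}=\mathfrak{B}\oplus\mathfrak{h}$ and $\widetilde{\mathfrak{G}}=\widetilde{\mathfrak{B}}\oplus\widetilde{\mathfrak{h}}$ be the canonical enveloping Lie algebras of $\mathfrak{B}$ and $\widetilde{\mathfrak{B}}$. The Bol algebras are isotopic if there exist a Lie algebra isomorphism $\Phi:\mathfrak{G}\to\widetilde{\mathfrak{G}}$ with $\Phi(\mathfrak{B})=\widetilde{\mathfrak{B}}$ and an element $\xi\in\widetilde{\mathfrak{B}}$ such that $\Phi(\mathfrak{h})=(\mathrm{Ad}\,\xi)\,\widetilde{\mathfrak{h}}$, where $\mathrm{Ad}\,\xi=\exp(\mathrm{ad}\,\xi)$. *)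

(* Defs.v *)
From mathcomp Require Import all_boot all_order all_algebra.
From mathcomp Require Import all_classical all_reals all_analysis.

Set Implicit Arguments.
Unset Strict Implicit.
Unset Printing Implicit Defensive.

Import Order.TTheory GRing.Theory Num.Theory.
Import numFieldNormedType.Exports VectorInternalTheory.

Local Open Scope classical_set_scope.
Local Open Scope ring_scope.

Record bolAlgebra (R : realType) (V : vectType R) := BolAlgebra {
  bol_mul : {bilinear V -> V -> V};
  bol_tri : V -> V -> V -> V;
  bol_tri_linear1 : forall y z, linear (fun x => bol_tri x y z);
  bol_tri_linear2 : forall x z, linear (fun y => bol_tri x y z);
  bol_tri_linear3 : forall x y, linear (bol_tri x y);
  bol_mulxx : forall x, bol_mul x x = 0;
  bol_trixx : forall x y, bol_tri x x y = 0;
  bol_tri_cyclic : forall x y z,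
    bol_tri x y z + bol_tri y z x + bol_tri z x y = 0;
  bol_tri_derivation : forall x y z u v,
    bol_tri x y (bol_tri z u v) =
      bol_tri (bol_tri x y z) u v + bol_tri z (bol_tri x y u) v
      + bol_tri z u (bol_tri x y v);
  bol_mul_tri : forall x y z u,
    bol_mul (bol_tri x y z) u - bol_mul (bol_tri x y u) z
    + bol_tri z u (bol_mul x y) - bol_tri x y (bol_mul z u)
    + bol_mul (bol_mul x y) (bol_mul z u) = 0
}.

Record lieAlgebra (R : realType) (G : vectType R) := LieAlgebra {
  lie_br : {bilinear G -> G -> G};
  lie_brxx : forall x, lie_br x x = 0;
  lie_jacobi : forall x y z,
    lie_br x (lie_br y z) + lie_br y (lie_br z x) + lie_br z (lie_br x y) = 0
}.

Section LieAlgebra.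
Variables (R : realType) (G : vectType R) (L : lieAlgebra G).

Definition lie_subalgebra (K : {vspace G}) : Prop :=
  forall x y, x \in K -> y \in K -> lie_br L x y \in K.

Definition lie_ideal (I : {vspace G}) : Prop :=
  forall x y, y \in I -> lie_br L x y \in I.

Definition lie_generates (U : {vspace G}) : Prop :=
  forall K : {vspace G}, lie_subalgebra K -> (U <= K)%VS -> K = fullv.

Definition lie_ad (x : G) : 'End(G) := linfun (lie_br L x).

End LieAlgebra.

(* A vectType carries no topology of its own: limits are taken on the
   coordinate vectors v2r, whose type 'rV[R]_n has the usual topology (the
   result does not depend on the coordinates). *)
Definition vlim (R : realType) (V : vectType R) (u : nat -> V) : V :=
  r2v (lim ((fun n => v2r (u n)) @ \oo)).

Definition lfun_exp (R : realType) (V : vectType R) (f : 'End(V)) : 'End(V) :=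
  vlim (fun n => \sum_(k < n) (k`!%:R)^-1 *: iter k (comp_lfun f) \1%VF).

Definition lie_Ad (R : realType) (G : vectType R) (L : lieAlgebra G) (x : G) :
  'End(G) := lfun_exp (lie_ad L x).

(* The inclusion of the Bol algebra in its enveloping Lie algebra is an
   injective linear map env_inj; limg env_inj is the copy of the Bol algebra
   inside env_lie. *)
Record envelopingPair (R : realType) (V : vectType R) (B : bolAlgebra V) :=
  EnvelopingPair {
  env_space : vectType R;
  env_lie : lieAlgebra env_space;
  env_inj : 'Hom(V, env_space);
  env_h : {vspace env_space};
  env_injP : lker env_inj = 0%VS;
  env_h_subalgebra : lie_subalgebra env_lie env_h;
  env_sum : (limg env_inj + env_h)%VS = fullv;
  env_direct : (limg env_inj :&: env_h)%VS = 0%VS;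
  env_closed : forall x y z,
    x \in limg env_inj -> y \in limg env_inj -> z \in limg env_inj ->
    lie_br env_lie (lie_br env_lie x y) z \in limg env_inj;
  env_mul : forall x y,
    env_inj (bol_mul B x y) =
      daddv_pi (limg env_inj) env_h
        (lie_br env_lie (env_inj x) (env_inj y));
  env_tri : forall x y z,
    env_inj (bol_tri B x y z) =
      lie_br env_lie (lie_br env_lie (env_inj x) (env_inj y)) (env_inj z)
}.

Definition env_canonical (R : realType) (V : vectType R) (B : bolAlgebra V)
    (E : envelopingPair B) : Prop :=
  lie_generates (env_lie E) (limg (env_inj E)) /\
  forall I : {vspace env_space E},
    lie_ideal (env_lie E) I -> (I <= env_h E)%VS -> I = 0%VS.

Definition lie_isomorphism (R : realType) (G G' : vectType R)
    (L : lieAlgebra G) (L' : lieAlgebra G') (Phi : 'Hom(G, G')) : Prop :=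
  bijective Phi /\
  forall x y, Phi (lie_br L x y) = lie_br L' (Phi x) (Phi y).

(* Two canonical enveloping pairs of the same Bol algebra are isomorphic by an
   isomorphism that is the identity on the Bol algebra, so it does not matter
   which ones are chosen here. *)
Definition bol_isotopic (R : realType) (V V' : vectType R)
    (B : bolAlgebra V) (B' : bolAlgebra V') : Prop :=
  exists (E : envelopingPair B) (E' : envelopingPair B'),
    [/\ env_canonical E, env_canonical E' &
      exists (Phi : 'Hom(env_space E, env_space E')) (xi : env_space E'),
        [/\ lie_isomorphism (env_lie E) (env_lie E') Phi,
            (Phi @: limg (env_inj E))%VS = limg (env_inj E'),
            xi \in limg (env_inj E') &
            (Phi @: env_h E)%VS = (lie_Ad (env_lie E') xi @: env_h E')%VS]].

(* In the two tables below e`_0, e`_1, e`_2 are e_1, e_2, e_3. *)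
Definition tri_table_IIIp (R : realType) (V : vectType R) (B : bolAlgebra V)
    (e : 3.-tuple V) : Prop :=
  forall i j k : 'I_3,
    bol_tri B e`_i e`_j e`_k =
      match val i, val j, val k with
      | 0%N, 1%N, 1%N => - e`_0
      | 1%N, 0%N, 1%N => e`_0
      | _, _, _ => 0
      end.

(* e_1 . e_2 = a, e_2 . e_1 = - a, and all other products of basis vectors
   are zero. *)
Definition mul_table (R : realType) (V : vectType R) (B : bolAlgebra V)
    (e : 3.-tuple V) (a : V) : Prop :=
  forall i j : 'I_3,
    bol_mul B e`_i e`_j =
      match val i, val j with
      | 0%N, 1%N => a
      | 1%N, 0%N => - a
      | _, _ => 0
      end.

Definition typeIIIp (R : realType) (V : vectType R) (B : bolAlgebra V) : Prop :=
  exists2 e : 3.-tuple V, basis_of fullv e & tri_table_IIIp B e.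

(* Main.v *)
From HB Require Import structures.
Require Import Defs.
From mathcomp Require Import all_boot all_order all_algebra.
From mathcomp Require Import all_classical all_reals all_analysis.
From mathcomp Require Import ring.

Set Implicit Arguments.
Unset Strict Implicit.
Unset Printing Implicit Defensive.
Import Order.TTheory GRing.Theory Num.Theory.
Import numFieldNormedType.Exports VectorInternalTheory.
Local Open Scope classical_set_scope.
Local Open Scope ring_scope.

(** Let e1, e2, e3 be a basis in which the trilinear operation has its normal
    form, identify the Bol algebra with its image in the enveloping Lie algebra,
    and put e4 = [e1, e2]. The trilinear table says how e4 and the other two
    brackets [e1, e3], [e2, e3] act on e1, e2, e3. With the Jacobi identity this
    forces [e1, e3] = [e2, e3] = 0 ([frame_br13], [frame_br23]) and shows that e4
    is not in the Bol algebra ([frame_br12_notin]); here it matters that -1 is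
    not a square. In dimension 4 the enveloping algebra is thus the Lie algebra of
    plane motions, with [e1, e2] = e4 and [e2, e4] = e1, plus the central line of
    e3. The only freedom left is the complement h, a line spanned by some
    e4 + x e1 + y e2 + z e3.

    Since ad e2 satisfies J^3 = - J, its exponential is a rotation
    ([lfun_exp_rotation]): Ad (t e2) rotates the plane of e1 and e4 and fixes e2
    and e3. Hence, for t = atan x, the line h is the image under Ad (t e2) of a
    line h' spanned by some e4 + Y e2 + Z e3 ([frame_rotate]). The same Lie
    algebra with the same three-dimensional subspace and the complement h' is a
    canonical enveloping pair of another Bol algebra ([bol_of_lie],
    [env_of_lie]), which is isotopic to the given one through the identity map
    ([isotopic_reduced]). It has the same trilinear operation, and
    e1 . e2 = - (Y e2 + Z e3) is its only product.

    The bases p e1, e2 + q e3, r e3 with p and r nonzero keep the trilinear table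
    ([rescaled_tables]), and a suitable one brings the product to the listed
    form: case (i) if Y is nonzero, case (ii) with z = 0 or 1 if Y = 0, according
    to whether Z vanishes. *)

(** * Exponential of an endomorphism with cube equal to its opposite *)

Lemma cvg_vlim (R : realType) (G : vectType R) (u : nat -> G) (l : G) :
  v2r (u n) @[n --> \oo] --> v2r l -> vlim u = l.
Proof. by move=> ul; rewrite /vlim (cvg_lim _ ul) ?v2rK. Qed.

Section Rotation.
Variables (R : realType) (G : vectType R).
Variable J : 'End(G).
Hypothesis J_cube : forall v, J (J (J v)) = - J v.

(** The powers of J are, up to sign, J in odd degree and J^2 in even positive
    degree, and the signs are those of the sine and of minus the cosine series. *)
Lemma lfun_exp_term (t : R) k :
  (k.+1`!%:R)^-1 *: iter k.+1 (comp_lfun (t *: J)) \1%VF =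
  sin_coeff t k.+1 *: J - cos_coeff t k.+1 *: (J \o J)%VF.
Proof.
suff -> : iter k.+1 (comp_lfun (t *: J)) \1%VF =
    (t ^+ k.+1 * (-1) ^+ k./2) *: (if odd k then J \o J else J)%VF.
  rewrite scalerA /sin_coeff /cos_coeff /= uphalf_half -?exprnP.
  case: (odd k); rewrite /= ?add1n ?add0n ?mul0r ?scale0r ?subr0 ?add0r.
    by rewrite -(scaleNr _ (J \o J)%VF); congr (_ *: _); rewrite ?exprS; ring.
  by congr (_ *: _); rewrite ?exprS; ring.
elim: k => [|k IH].
  by rewrite /= comp_lfun1r expr0 expr1 mulr1.
rewrite iterS {}IH; apply/lfunP => v.
rewrite /= uphalf_half.
case: (odd k); rewrite /= !(scale_lfunE, comp_lfunE, linearZ) /= ?J_cube.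
  by rewrite -(scaleN1r (J v)) !scalerA; congr (_ *: _); rewrite !exprS; ring.
by rewrite scalerA; congr (_ *: _); rewrite !exprS; ring.
Qed.

(** The constant term 1 of the cosine series is compensated by the 1 in the last
    coefficient, because the term of degree 0 is the identity and not J^2. *)
Lemma lfun_exp_partial_sum (t : R) n :
  \sum_(k < n.+1) (k`!%:R)^-1 *: iter k (comp_lfun (t *: J)) \1%VF =
  \1%VF + series (sin_coeff t) n.+1 *: J
        + (1 - series (cos_coeff t) n.+1) *: (J \o J)%VF :> 'End(G).
Proof.
rewrite /series /=; elim: n => [|n IH].
  rewrite big_ord1 !big_nat1 /= /sin_coeff /cos_coeff /= fact0 expr0.
  by rewrite !mul1r !mul0r invr1 subrr !scale0r scale1r !addr0.
rewrite big_ord_recr IH lfun_exp_term !(big_nat_recr n.+1) //=.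
rewrite opprD !scalerDl !scaleNr -!addrA.
do 2 congr (_ + _); rewrite [RHS]addrCA; congr (_ + _); exact: addrCA.
Qed.

Lemma lfun_exp_rotation (t : R) :
  lfun_exp (t *: J) = \1%VF + sin t *: J + (1 - cos t) *: (J \o J)%VF.
Proof.
rewrite /lfun_exp; apply: cvg_vlim; rewrite -cvg_shiftS /=.
under eq_fun do rewrite lfun_exp_partial_sum !linearD /= !linearZ /=.
rewrite !linearD /= !linearZ /=.
have cs : series (sin_coeff t) n.+1 @[n --> \oo] --> sin t.
  rewrite (cvg_shiftS (series (sin_coeff t))) sin.unlock.
  exact: is_cvg_series_sin_coeff.
have cc : series (cos_coeff t) n.+1 @[n --> \oo] --> cos t.
  rewrite (cvg_shiftS (series (cos_coeff t))) cos.unlock.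
  exact: is_cvg_series_cos_coeff.
apply: cvgD; first apply: cvgD; first exact: cvg_cst.
  exact: cvgZr_tmp cs.
by apply: cvgZr_tmp; apply: cvgB => //; exact: cvg_cst.
Qed.

End Rotation.

(** * Bol algebra of a Lie algebra with a complemented subspace *)

Section LieIdentities.
Variables (R : realType) (G : vectType R) (L : lieAlgebra G).
Local Notation "{[ x , y ]}" := (lie_br L x y).

Lemma lie_skew x y : {[x, y]} = - {[y, x]}.
Proof.
apply/eqP; rewrite -addr_eq0; apply/eqP.
by have := lie_brxx L (x + y); rewrite linearDl !linearDr !lie_brxx add0r addr0.
Qed.

Lemma lie_derivation a x y : {[a, {[x, y]}]} = {[{[a, x]}, y]} + {[x, {[a, y]}]}.
Proof.
have := lie_jacobi L a x y.
rewrite (lie_skew y a) (lie_skew y) linearNr => /eqP.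
by rewrite -addrA -opprD subr_eq0 => /eqP ->; rewrite addrC.
Qed.

End LieIdentities.

Lemma daddv_pi_eq0 (K : fieldType) (V : vectType K) (U W : {vspace V}) w :
  (U :&: W = 0)%VS -> w \in W -> daddv_pi U W w = 0.
Proof.
move=> dUW wW; have := daddv_pi_add dUW (subvP (addvSr U W) w wW).
by rewrite (daddv_pi_id _ wW) ?(capvC W) // => /eqP; rewrite -subr_eq0 addrK => /eqP.
Qed.

Section BolOfLie.
Variables (R : realType) (V G : vectType R) (L : lieAlgebra G).
Variables (j : 'Hom(V, G)) (h : {vspace G}).
Hypothesis jP : lker j = 0%VS.
Hypothesis h_subalgebra : lie_subalgebra L h.
Hypothesis sum_h : (limg j + h)%VS = fullv.
Hypothesis direct_h : (limg j :&: h)%VS = 0%VS.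
Hypothesis closed_j : forall x y z,
  x \in limg j -> y \in limg j -> z \in limg j ->
  lie_br L (lie_br L x y) z \in limg j.

Local Notation "{[ x , y ]}" := (lie_br L x y).
Local Notation P := (daddv_pi (limg j) h).

Definition lie_mul (x y : V) : V := (j^-1)%VF (P {[j x, j y]}).
Definition lie_tri (x y z : V) : V := (j^-1)%VF {[{[j x, j y]}, j z]}.

Let j_inj : injective j.
Proof. by apply/lker0P; rewrite jP. Qed.

Let jV x : j x \in limg j.
Proof. by rewrite memv_img ?memvf. Qed.

Lemma lie_mulE x y : j (lie_mul x y) = P {[j x, j y]}.
Proof. by rewrite limg_lfunVK ?memv_pi. Qed.

Lemma lie_triE x y z : j (lie_tri x y z) = {[{[j x, j y]}, j z]}.
Proof. by rewrite limg_lfunVK ?closed_j. Qed.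

Let P_id x : x \in limg j -> P x = x.
Proof. exact: daddv_pi_id. Qed.

Let P_h x : x - P x \in h.
Proof.
have e : P x + daddv_pi h (limg j) x = x.
  by rewrite daddv_pi_add // sum_h memvf.
by rewrite -[X in X - _]e addrC addKr memv_pi.
Qed.

Lemma lie_mul_bilinear : bilinear_for *:%R *:%R lie_mul.
Proof.
by split => z a x y; rewrite /lie_mul !linearP //= linearPl !linearP.
Qed.

HB.instance Definition _ :=
  bilinear_isBilinear.Build R V V V *:%R *:%R lie_mul lie_mul_bilinear.

Lemma lie_tri_linear1 y z : linear (fun x => lie_tri x y z).
Proof. by move=> a x x'; rewrite /lie_tri linearP !linearPl linearP. Qed.

Lemma lie_tri_linear2 x z : linear (fun y => lie_tri x y z).
Proof. by move=> a y y'; rewrite /lie_tri linearP linearPr linearPl linearP. Qed.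

Lemma lie_tri_linear3 x y : linear (lie_tri x y).
Proof. by move=> a z z'; rewrite /lie_tri linearP linearPr linearP. Qed.

Lemma lie_mulxx x : lie_mul x x = 0.
Proof. by rewrite /lie_mul lie_brxx !linear0. Qed.

Lemma lie_trixx x y : lie_tri x x y = 0.
Proof. by rewrite /lie_tri lie_brxx linear0l linear0. Qed.

Lemma lie_tri_cyclic x y z :
  lie_tri x y z + lie_tri y z x + lie_tri z x y = 0.
Proof.
rewrite /lie_tri -!linearD /=.
rewrite !(lie_skew L {[_, _]}) -!opprD -addrA [_ + (_ + _)]addrC.
by rewrite lie_jacobi oppr0 linear0.
Qed.

Lemma lie_tri_derivation x y z u v :
  lie_tri x y (lie_tri z u v) =
    lie_tri (lie_tri x y z) u v + lie_tri z (lie_tri x y u) v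
    + lie_tri z u (lie_tri x y v).
Proof.
by apply: j_inj; rewrite !linearD /= !lie_triE -linearDl -!lie_derivation.
Qed.

(** Write A = [x, y] and C = [z, u]. The first two terms add up to P [A, C], as
    ad A is a derivation; the third and the fourth, [C, P A] and - [A, P C], are
    already in the subspace, so that P fixes them. The whole sum is therefore
    P [A - P A, C - P C], and both entries are in the subalgebra h. *)
Lemma lie_mul_tri x y z u :
  lie_mul (lie_tri x y z) u - lie_mul (lie_tri x y u) z
  + lie_tri z u (lie_mul x y) - lie_tri x y (lie_mul z u)
  + lie_mul (lie_mul x y) (lie_mul z u) = 0.
Proof.
apply: j_inj; rewrite !linearD !linearN linear0 /= !(lie_mulE, lie_triE).
set A := {[j x, j y]}; set C := {[j z, j u]}.
rewrite -(P_id (closed_j (jV z) (jV u) (memv_pi _ _ A))).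
rewrite -(P_id (closed_j (jV x) (jV y) (memv_pi _ _ C))).
rewrite -!(linearN P) -!(linearD P) /=; apply: daddv_pi_eq0 => //; rewrite -/A -/C.
suff -> : {[{[A, j z]}, j u]} - {[{[A, j u]}, j z]} + {[C, P A]} - {[A, P C]}
    + {[P A, P C]} = {[A - P A, C - P C]} by apply: h_subalgebra; apply: P_h.
rewrite (lie_skew L {[A, j u]}) opprK -lie_derivation -/C.
rewrite linearBl !linearBr (lie_skew L C) opprB.
by rewrite (addrAC {[A, C]}) -!addrA; do 2 congr (_ + _); rewrite addrC.
Qed.

Definition bol_of_lie : bolAlgebra V :=
  @BolAlgebra R V lie_mul lie_tri lie_tri_linear1 lie_tri_linear2
    lie_tri_linear3 lie_mulxx lie_trixx lie_tri_cyclic lie_tri_derivation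
    lie_mul_tri.

Definition env_of_lie : envelopingPair bol_of_lie :=
  @EnvelopingPair R V bol_of_lie G L j h jP h_subalgebra sum_h direct_h
    closed_j lie_mulE lie_triE.

End BolOfLie.

(** * Structure of the enveloping Lie algebra *)

(** The hypotheses are the entries of the trilinear table of Type III+ from which
    the rest of the Lie bracket can be recovered; a1, a2, a3 stand for the images
    of the basis of the Bol algebra. *)
Section Frame.
Variables (R : realType) (G : vectType R) (L : lieAlgebra G).
Local Notation "{[ x , y ]}" := (lie_br L x y).
Variables a1 a2 a3 : G.
Local Notation a4 := {[a1, a2]}.
Hypothesis free_a : free [:: a1; a2; a3].
Hypothesis a41 : {[a4, a1]} = 0.
Hypothesis a42 : {[a4, a2]} = - a1.
Hypothesis a43 : {[a4, a3]} = 0.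
Hypothesis a231 : {[{[a2, a3]}, a1]} = 0.
Hypothesis a232 : {[{[a2, a3]}, a2]} = 0.

Let a23_4 : {[a4, {[a2, a3]}]} = 0.
Proof. by rewrite lie_skew lie_derivation a231 a232 linear0l linear0r addr0 oppr0. Qed.

(** The bracket [a2, a3] commutes with a1 and a2, hence with a4 = [a1, a2];
    expanding [a4, [a2, a3]] = 0 by the derivation rule leaves - [a1, a3]. *)
Lemma frame_br13 : {[a1, a3]} = 0.
Proof.
apply/oppr_inj; rewrite oppr0 -[RHS]a23_4 lie_derivation a42 a43.
by rewrite linear0r addr0 linearNl.
Qed.

Let a1_neq0 : a1 != 0.
Proof. by apply: (free_not0 free_a); rewrite inE eqxx. Qed.

Let a4_neq0 : a4 != 0.
Proof.
apply: contra a1_neq0 => /eqP a40.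
by rewrite -oppr_eq0 -a42 a40 linear0l.
Qed.

Lemma frame_span3 v : v \in <<[:: a1; a2; a3]>>%VS ->
  exists x y z, v = x *: a1 + y *: a2 + z *: a3.
Proof.
rewrite !span_cons span_nil addv0 => /memv_addP[_ /vlineP[x ->] [v' + ->]].
move=> /memv_addP[_ /vlineP[y ->] [_ /vlineP[z ->] ->]].
by exists x, y, z; rewrite addrA.
Qed.

(** If a4 were x a1 + y a2 + z a3, then [a4, a1] = 0 would give y = 0, and
    bracketing [a4, a2] = - a1 with a2 would give a4 = x a1, whence
    x^2 a1 = - a1. *)
Lemma frame_br12_notin : a4 \notin <<[:: a1; a2; a3]>>%VS.
Proof.
apply/negP => /frame_span3[x [y [z e4]]].
have y0 : y = 0.
  apply/eqP; have /eqP := a41; rewrite {1}e4 !linearDl /= !linearZl_LR lie_brxx.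
  rewrite (lie_skew L a2) (lie_skew L a3) frame_br13 oppr0 !scaler0 add0r addr0.
  by rewrite scalerN oppr_eq0 scaler_eq0 (negPf a4_neq0) orbF.
have e1 : x *: a4 - z *: {[a2, a3]} = - a1.
  rewrite -a42 [in RHS]e4 y0 scale0r addr0 linearDl /= !linearZl_LR.
  by rewrite (lie_skew L a3) scalerN.
have e41 : a4 = x *: a1.
  apply/oppr_inj; rewrite -linearNl -e1 linearBl /= !linearZl_LR a42 a232.
  by rewrite scaler0 subr0 scalerN.
have : {[x *: a1, a2]} = - a1 by rewrite -e41.
rewrite linearZl_LR /= e41 scalerA => /eqP.
rewrite -subr_eq0 opprK -{2}[a1]scale1r -scalerDl scaler_eq0 (negPf a1_neq0) orbF.
by rewrite gt_eqF // ltr_wpDl // -expr2 sqr_ge0.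
Qed.

Hypothesis dimG : \dim {:G} = 4%N.

Lemma frame_basis : basis_of fullv [:: a4; a1; a2; a3].
Proof.
rewrite basisEfree free_cons frame_br12_notin free_a subvf /=.
by rewrite dimG.
Qed.

(** The coordinate on [a1, a2] comes first, so that the vectors with w = 0 are
    those of the Bol algebra. *)
Definition frame_vec w x y z : G := w *: a4 + (x *: a1 + y *: a2 + z *: a3).

Lemma frame_vecD w x y z w' x' y' z' :
  frame_vec w x y z + frame_vec w' x' y' z' =
  frame_vec (w + w') (x + x') (y + y') (z + z').
Proof.
rewrite /frame_vec !scalerDl addrACA; congr (_ + _).
by rewrite addrACA; congr (_ + _); rewrite addrACA.
Qed.

Lemma frame_vecZ k w x y z :
  k *: frame_vec w x y z = frame_vec (k * w) (k * x) (k * y) (k * z).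
Proof. by rewrite /frame_vec !scalerDr !scalerA. Qed.

Lemma frame_span v : exists w x y z, v = frame_vec w x y z.
Proof.
have: v \in <<[:: a4; a1; a2; a3]>>%VS by rewrite (span_basis frame_basis) memvf.
rewrite span_cons => /memv_addP[_ /vlineP[w ->] [u /frame_span3[x [y [z ->]]] ->]].
by exists w, x, y, z.
Qed.

Lemma frame_vec_eq0 w x y z :
  frame_vec w x y z = 0 -> [/\ w = 0, x = 0, y = 0 & z = 0].
Proof.
have cons_eq0 (k : R) (v u : G) X :
    free (v :: X) -> u \in <<X>>%VS -> k *: v + u = 0 -> k = 0 /\ u = 0.
  rewrite free_cons => /andP[vX _] uX; have [->|k0] := eqVneq k 0.
    by rewrite scale0r add0r.
  move=> /eqP; rewrite addr_eq0 => /eqP e; case/negP: vX.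
  by rewrite -[v](scalerK k0) e rpredZ // rpredN.
have f4 := basis_free frame_basis.
rewrite /frame_vec -!addrA => /(cons_eq0 _ _ _ _ f4)[].
  by rewrite !rpredD // rpredZ // memv_span // !inE eqxx ?orbT.
move=> -> /(cons_eq0 _ _ _ _ free_a)[].
  by rewrite !rpredD // rpredZ // memv_span // !inE eqxx ?orbT.
have /andP[_ f2] : (a1 \notin <<[:: a2; a3]>>%VS) && free [:: a2; a3].
  by rewrite -free_cons.
move=> -> /(cons_eq0 _ _ _ _ f2)[]; first by rewrite rpredZ // memv_span // inE.
move=> -> /eqP; rewrite scaler_eq0 => /orP[/eqP-> //|/eqP a30].
by have := free_not0 f2 (_ : a3 \in _); rewrite a30 eqxx !inE eqxx orbT => /(_ isT).
Qed.

Lemma frame_ad4 w x y z :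
  {[a4, frame_vec w x y z]} = frame_vec 0 (- y) 0 0.
Proof.
rewrite !linearDr /= !linearZr_LR /= lie_brxx a41 a42 a43 /frame_vec.
by rewrite !scaler0 !scale0r !add0r !addr0 scalerN scaleNr.
Qed.

Let frame_ad2_aux w x y z :
  {[a2, frame_vec w x y z]} = frame_vec (- x) w 0 0 + z *: {[a2, a3]}.
Proof.
rewrite !linearDr /= !linearZr_LR /= lie_brxx (lie_skew L a2 a1).
rewrite (lie_skew L a2 a4) a42 opprK /frame_vec !scaler0 !scale0r !addr0.
by rewrite addrA scalerN scaleNr [X in X + _]addrC.
Qed.

(** If d = [a2, a3] has coordinates (w, x, y, z), then 0 = [a2, d] has
    coordinates (z w - x, w + z x, z y, z^2): this gives z = 0 and then
    w = x = 0, while y = 0 follows from [a4, d] = 0. *)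
Lemma frame_br23 : {[a2, a3]} = 0.
Proof.
have [w [x [y [z e]]]] := frame_span {[a2, a3]}.
have : {[a2, {[a2, a3]}]} = 0 by rewrite lie_skew a232 oppr0.
rewrite {1}e frame_ad2_aux e frame_vecZ frame_vecD => /frame_vec_eq0[zw zx zy zz].
have z0 : z = 0.
  by apply/eqP; rewrite -[_ == _]orbb -mulf_eq0 -zz add0r.
have /frame_vec_eq0[_ y0 _ _] : frame_vec 0 (- y) 0 0 = 0.
  by rewrite -[RHS]a23_4 e frame_ad4.
move: zw zx y0; rewrite z0 !mul0r !addr0 => /eqP + w0 /eqP.
rewrite !oppr_eq0 => /eqP x0 /eqP y0.
by rewrite w0 x0 y0 /frame_vec !scale0r !addr0.
Qed.

Lemma frame_ad2 w x y z : {[a2, frame_vec w x y z]} = frame_vec (- x) w 0 0.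
Proof. by rewrite frame_ad2_aux frame_br23 scaler0 addr0. Qed.

Lemma frame_ad2_cube v : {[a2, {[a2, {[a2, v]}]}]} = - {[a2, v]}.
Proof.
have [w [x [y [z ->]]]] := frame_span v.
rewrite !frame_ad2 -(scaleN1r (frame_vec _ _ _ _)) frame_vecZ.
by rewrite !mulN1r oppr0 opprK.
Qed.

Lemma frame_Ad2 t w x y z :
  lie_Ad L (t *: a2) (frame_vec w x y z) =
  frame_vec (cos t * w - sin t * x) (sin t * w + cos t * x) y z.
Proof.
have -> : lie_Ad L (t *: a2) = lfun_exp (t *: lie_ad L a2).
  congr lfun_exp; apply/lfunP => v.
  by rewrite scale_lfunE !lfunE /= linearZl_LR.
rewrite lfun_exp_rotation => [|v]; last by rewrite !lfunE /= frame_ad2_cube.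
rewrite !(add_lfunE, scale_lfunE, comp_lfunE) id_lfunE /lie_ad !lfunE /=.
by rewrite !frame_ad2 !frame_vecZ !frame_vecD; congr frame_vec; ring.
Qed.

Lemma frame_vec_notin Y Z : frame_vec 1 0 Y Z \notin <<[:: a1; a2; a3]>>%VS.
Proof.
apply/negP => wU; case/negP: frame_br12_notin.
have -> : a4 = frame_vec 1 0 Y Z - (0 *: a1 + Y *: a2 + Z *: a3).
  by rewrite /frame_vec scale1r addrK.
by rewrite rpredB // !rpredD // rpredZ // memv_span // !inE eqxx ?orbT.
Qed.

(** If k times the generator is in the ideal, then so is its bracket k a1 with
    a2, which lies on the line only if k = 0. *)
Lemma frame_ideal_eq0 Y Z (I : {vspace G}) :
  lie_ideal L I -> (I <= <[frame_vec 1 0 Y Z]>)%VS -> I = 0%VS.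
Proof.
move=> idI /subvP sI; apply/eqP; rewrite -subv0; apply/subvP => v vI.
have /vlineP[k vE] := sI _ vI; have /vlineP[m] := sI _ (idI a2 _ vI).
rewrite vE linearZr_LR /= frame_ad2 !frame_vecZ => /eqP.
rewrite -subr_eq0 -(scaleN1r (frame_vec _ _ _ _)) frame_vecZ frame_vecD.
move=> /eqP/frame_vec_eq0[+ + _ _].
rewrite !mulr0 !mulr1 oppr0 mulr0 add0r addr0 => _ ->.
by rewrite /frame_vec !mul0r !scale0r !addr0 memv0.
Qed.

(** For t = atan x, the rotation Ad (t a2) maps a4 to
    cos t a4 + sin t a1 = cos t (a4 + x a1); scaling y and z by cos t makes the
    image of the whole generator proportional to the given one. *)
Lemma frame_rotate x y z : exists t Y Z,
  (lie_Ad L (t *: a2) @: <[frame_vec 1 0 Y Z]>)%VS = <[frame_vec 1 x y z]>%VS.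
Proof.
have c0 : cos (atan x) != 0.
  by rewrite gt_eqF // cos_gt0_pihalf // atan_gtNpi2 atan_ltpi2.
exists (atan x), (cos (atan x) * y), (cos (atan x) * z).
have sE : sin (atan x) = cos (atan x) * x.
  by rewrite -{3}[x]atanK /tan mulrCA divff ?mulr1.
rewrite limg_line frame_Ad2 !mulr0 !mulr1 subr0 addr0 sE.
have -> : frame_vec (cos (atan x)) (cos (atan x) * x) (cos (atan x) * y)
    (cos (atan x) * z) = cos (atan x) *: frame_vec 1 x y z.
  by rewrite frame_vecZ mulr1.
apply/eqP; rewrite eqEsubv; apply/andP; split.
  by rewrite -memvE rpredZ ?memv_line.
by rewrite -memvE -{1}[frame_vec _ _ _ _](scalerK c0) rpredZ ?memv_line.
Qed.

Lemma frame_br x y z x' y' z' :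
  {[frame_vec 0 x y z, frame_vec 0 x' y' z']} = (x * y' - y * x') *: a4.
Proof.
rewrite /frame_vec !scale0r !add0r.
rewrite !(linearDl, linearDr) /= !(linearZl_LR, linearZr_LR) /=.
rewrite !lie_brxx (lie_skew L a2 a1) (lie_skew L a3) (lie_skew L a3 a2).
rewrite frame_br13 frame_br23 oppr0 !scaler0 !addr0 !add0r.
by rewrite scalerN !scalerN !scalerA scalerBl.
Qed.

Lemma frame_tri x y z x' y' z' x'' y'' z'' :
  {[{[frame_vec 0 x y z, frame_vec 0 x' y' z']}, frame_vec 0 x'' y'' z'']} =
  frame_vec 0 (- ((x * y' - y * x') * y'')) 0 0.
Proof.
by rewrite frame_br linearZl_LR /= frame_ad4 frame_vecZ !mulr0 mulrN.
Qed.

Local Notation U := <<[:: a1; a2; a3]>>%VS.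

Lemma frame_direct Y Z : (U :&: <[frame_vec 1 0 Y Z]> = 0)%VS.
Proof.
apply/eqP; rewrite -subv0; apply/subvP => v /memv_capP[vU /vlineP[k vE]].
have [k0|k0] := eqVneq k 0; first by rewrite vE k0 scale0r mem0v.
case/negP: (frame_vec_notin Y Z).
by rewrite -[frame_vec _ _ _ _](scalerK k0) -vE rpredZ.
Qed.

Lemma frame_sum Y Z : (U + <[frame_vec 1 0 Y Z]> = fullv)%VS.
Proof.
apply/eqP; rewrite eqEdim subvf dimG dimv_disjoint_sum ?frame_direct //.
rewrite (eqnP free_a) dim_vline.
have -> // : frame_vec 1 0 Y Z != 0.
by apply: contra (frame_vec_notin Y Z) => /eqP ->; rewrite mem0v.
Qed.

Lemma frame_proj Y Z :
  daddv_pi U <[frame_vec 1 0 Y Z]> a4 = frame_vec 0 0 (- Y) (- Z).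
Proof.
have dUw := frame_direct Y Z.
have -> : a4 = frame_vec 1 0 Y Z + frame_vec 0 0 (- Y) (- Z).
  by rewrite frame_vecD !addrN !addr0 /frame_vec scale1r !scale0r !addr0.
rewrite linearD /= daddv_pi_eq0 ?memv_line // add0r daddv_pi_id //.
by rewrite /frame_vec !scale0r !add0r rpredD // rpredZ // memv_span // !inE eqxx ?orbT.
Qed.

End Frame.

(** * Reduction to the normal forms *)

Lemma rescaled_basis (R : realType) (V : vectType R) (e1 e2 e3 : V) (p q r : R) :
  basis_of fullv [:: e1; e2; e3] -> p != 0 -> r != 0 ->
  basis_of fullv [:: p *: e1; e2 + q *: e3; r *: e3].
Proof.
move=> be p0 r0; set e' := [:: _; _; _].
have := be; rewrite !basisEdim /= => /andP[/subv_trans sub ->]; rewrite andbT.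
apply: sub; apply/span_subvP => v; rewrite !inE.
have i1 : e1 \in <<e'>>%VS.
  by rewrite -{1}[e1](scalerK p0) rpredZ // memv_span // !inE eqxx.
have i3 : e3 \in <<e'>>%VS.
  by rewrite -{1}[e3](scalerK r0) rpredZ // memv_span // !inE eqxx !orbT.
have i2 : e2 \in <<e'>>%VS.
  rewrite -{1}[e2](addrK (q *: e3)) rpredB // ?rpredZ // memv_span //.
  by rewrite !inE eqxx /= orbT.
by case/or3P => /eqP ->.
Qed.

Definition lin3 (R : realType) (V : vectType R) (e1 e2 e3 : V) (x y z : R) : V :=
  x *: e1 + y *: e2 + z *: e3.

(** The Bol algebra with the trilinear operation of Type III+ and with
    e1 . e2 = - (Y e2 + Z e3) as its only product of basis vectors, written in
    coordinates so that it can be evaluated in any basis. *)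
Definition reduced_bol (R : realType) (V : vectType R) (B : bolAlgebra V)
    (e1 e2 e3 : V) (Y Z : R) : Prop :=
  (forall x1 y1 z1 x2 y2 z2 x3 y3 z3,
    bol_tri B (lin3 e1 e2 e3 x1 y1 z1) (lin3 e1 e2 e3 x2 y2 z2)
      (lin3 e1 e2 e3 x3 y3 z3) =
    lin3 e1 e2 e3 (- ((x1 * y2 - y1 * x2) * y3)) 0 0) /\
  (forall x1 y1 z1 x2 y2 z2,
    bol_mul B (lin3 e1 e2 e3 x1 y1 z1) (lin3 e1 e2 e3 x2 y2 z2) =
    lin3 e1 e2 e3 0 (- ((x1 * y2 - y1 * x2) * Y))
      (- ((x1 * y2 - y1 * x2) * Z))).

(** Only the complement h is changed: the new one is spanned by some
    a4 + Y a2 + Z a3, and a rotation Ad (t a2) carries it to the old one, so that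
    the identity of the Lie algebra is an isotopy. *)
Lemma isotopic_reduced (R : realType) (V : vectType R) (B : bolAlgebra V)
    (E : envelopingPair B) :
  typeIIIp B -> env_canonical E -> \dim {:env_space E} = 4%N ->
  exists (B' : bolAlgebra V) (e1 e2 e3 : V) (Y Z : R),
    [/\ bol_isotopic B B', basis_of fullv [:: e1; e2; e3] &
        reduced_bol B' e1 e2 e3 Y Z].
Proof.
move=> triB canE dimE.
case: triB => -[[|e1 [|e2 [|e3 [|//]]]] s3] //= be tri.
set L := env_lie E; set j := env_inj E.
have jP : lker j = 0%VS := env_injP E.
have j_inj : injective j by apply/lker0P; rewrite jP.
have ba : basis_of (limg j) [:: j e1; j e2; j e3].
  by apply: (limg_basis_of _ be); rewrite jP capv0.
have jU := span_basis ba; have fa := basis_free ba.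
have tE (x y z : V) : lie_br L (lie_br L (j x) (j y)) (j z) = j (bol_tri B x y z).
  by rewrite env_tri.
pose i0 := @Ordinal 3 0 isT; pose i1 := @Ordinal 3 1 isT.
pose i2 := @Ordinal 3 2 isT.
have a41 : lie_br L (lie_br L (j e1) (j e2)) (j e1) = 0.
  by rewrite tE (tri i0 i1 i0) linear0.
have a42 : lie_br L (lie_br L (j e1) (j e2)) (j e2) = - j e1.
  by rewrite tE (tri i0 i1 i1) linearN.
have a43 : lie_br L (lie_br L (j e1) (j e2)) (j e3) = 0.
  by rewrite tE (tri i0 i1 i2) linear0.
have a231 : lie_br L (lie_br L (j e2) (j e3)) (j e1) = 0.
  by rewrite tE (tri i1 i2 i0) linear0.
have a232 : lie_br L (lie_br L (j e2) (j e3)) (j e2) = 0.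
  by rewrite tE (tri i1 i2 i1) linear0.
pose F := frame_vec L (j e1) (j e2) (j e3).
have [x [y [z hE]]] : exists x y z, env_h E = <[F 1 x y z]>%VS.
  have /memv_addP[u uU [g gh a4E]] :
      lie_br L (j e1) (j e2) \in (limg j + env_h E)%VS.
    by rewrite env_sum memvf.
  move: uU; rewrite -jU => /frame_span3[x [y [z uE]]].
  (* g = a4 - u generates h, since a4 is not in the Bol algebra and dim h = 1. *)
  exists (- x), (- y), (- z).
  have -> : F 1 (- x) (- y) (- z) = g.
    rewrite /F /frame_vec scale1r a4E uE !scaleNr -!opprD.
    by rewrite [_ + g]addrC addrK.
  apply/esym/eqP; rewrite eqEdim -memvE gh.
  have := dimv_disjoint_sum (env_direct E).
  rewrite env_sum dimE -jU (eqnP fa) dim_vline => /eqP.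
  rewrite -[4%N]/(3 + 1)%N eqn_add2l => /eqP <-.
  have -> // : g != 0.
  apply: contra (frame_br12_notin fa a41 a42 a43 a231 a232) => /eqP g0.
  by rewrite a4E g0 addr0 uE !rpredD // rpredZ // memv_span // !inE eqxx ?orbT.
have [t [Y [Z rot]]] :=
  frame_rotate fa a41 a42 a43 a231 a232 dimE x y z.
pose w := F 1 0 Y Z.
have w_sub : lie_subalgebra L <[w]>%VS.
  move=> _ _ /vlineP[k ->] /vlineP[l ->].
  by rewrite linearZl_LR linearZr_LR /= lie_brxx !scaler0 mem0v.
have w_sum : (limg j + <[w]>)%VS = fullv.
  by rewrite -jU; exact: frame_sum.
have w_direct : (limg j :&: <[w]>)%VS = 0%VS.
  by rewrite -jU; exact: frame_direct.
pose B' := bol_of_lie jP w_sub w_sum w_direct (env_closed (e := E)).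
pose E' : envelopingPair B' :=
  env_of_lie jP w_sub w_sum w_direct (env_closed (e := E)).
have iso : bol_isotopic B B'.
  exists E, E'; split => //.
    split; first exact: canE.1.
    by move=> I; exact: frame_ideal_eq0.
  exists \1%VF, (t *: j e2); split => /=.
  - split; first by exists (\1%VF : 'End(_)) => v; rewrite !id_lfunE.
    by move=> u v; rewrite !id_lfunE.
  - by rewrite lim1g.
  - by rewrite rpredZ // memv_img ?memvf.
  - by rewrite lim1g hE -rot.
have jl x' y' z' : j (lin3 e1 e2 e3 x' y' z') = F 0 x' y' z'.
  by rewrite /F /frame_vec scale0r add0r !linearD /= !linearZ.
exists B', e1, e2, e3, Y, Z; split => //; split=> *; apply: j_inj; rewrite !jl.
  rewrite [LHS]lie_triE ?jl ?frame_tri //; exact: env_closed.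
rewrite [LHS]lie_mulE !jl frame_br // linearZ /=.
by rewrite -jU frame_proj // frame_vecZ !mulr0 !mulrN.
Qed.

(** The trilinear table survives because e3 is in the kernel of both operations and
    e1 occurs exactly once in the nonzero entries and in their values. *)
Lemma rescaled_tables (R : realType) (V : vectType R) (B : bolAlgebra V)
    (e1 e2 e3 : V) (Y Z p q r : R) :
  basis_of fullv [:: e1; e2; e3] -> p != 0 -> r != 0 ->
  reduced_bol B e1 e2 e3 Y Z ->
  let e := [tuple p *: e1; e2 + q *: e3; r *: e3] in
  [/\ basis_of fullv e, tri_table_IIIp B e &
      mul_table B e (- (p *: (Y *: e2 + Z *: e3)))].
Proof.
move=> be p0 r0 [triE mulE] e.
have v1 : p *: e1 = lin3 e1 e2 e3 p 0 0 by rewrite /lin3 !scale0r !addr0.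
have v2 : e2 + q *: e3 = lin3 e1 e2 e3 0 1 q.
  by rewrite /lin3 scale1r !scale0r !add0r.
have v3 : r *: e3 = lin3 e1 e2 e3 0 0 r by rewrite /lin3 !scale0r !add0r.
have v0 : 0 = lin3 e1 e2 e3 0 0 0 by rewrite /lin3 !scale0r !add0r.
have vN x y z : - lin3 e1 e2 e3 x y z = lin3 e1 e2 e3 (- x) (- y) (- z).
  by rewrite /lin3 !opprD !scaleNr.
have vM : p *: (Y *: e2 + Z *: e3) = lin3 e1 e2 e3 0 (p * Y) (p * Z).
  by rewrite /lin3 scalerDr !scalerA scale0r add0r.
split; first exact: rescaled_basis.
- move=> [[|[|[|//]]] ?] [[|[|[|//]]] ?] [[|[|[|//]]] ?] /=;
    by rewrite ?v1 ?v2 ?v3 triE ?vN ?v0; congr lin3; ring.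
- move=> [[|[|[|//]]] ?] [[|[|[|//]]] ?] /=;
    by rewrite ?vM ?v1 ?v2 ?v3 mulE ?vN ?v0; congr lin3; ring.
Qed.

Theorem mainTheorem9 (R : realType) (V : vectType R) (B : bolAlgebra V)
    (dimB : \dim {:V} = 3%N) (triB : typeIIIp B)
    (E : envelopingPair B) (canE : env_canonical E)
    (dimE : \dim {:env_space E} = 4%N) :
  exists (V' : vectType R) (B' : bolAlgebra V') (e : 3.-tuple V'),
    [/\ bol_isotopic B B', basis_of fullv e, tri_table_IIIp B' e &
        mul_table B' e (- e`_1) \/
        exists2 z : R, z = 0 \/ z = 1 & mul_table B' e (- (z *: e`_2))].
Proof.
have [B' [e1 [e2 [e3 [Y [Z [iso be red]]]]]]] :=
  isotopic_reduced triB canE dimE.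
have tables p q r p0 r0 := @rescaled_tables _ _ _ _ _ _ _ _ p q r be p0 r0 red.
have [Y0|Y0] := eqVneq Y 0; last first.
  have [be' tri' mul'] := tables Y^-1 (Z / Y) 1 (invr_neq0 Y0) (oner_neq0 _).
  exists V, B', [tuple Y^-1 *: e1; e2 + (Z / Y) *: e3; 1 *: e3]; split => //; left.
  by move: mul'; rewrite scalerDr scalerK // scalerA mulrC.
have [Z0|Z0] := eqVneq Z 0.
  have [be' tri' mul'] := tables 1 0 1 (oner_neq0 _) (oner_neq0 _).
  exists V, B', [tuple 1 *: e1; e2 + 0 *: e3; 1 *: e3]; split => //; right.
  exists 0; first by left.
  by move: mul'; rewrite Y0 Z0 !(scale0r, addr0, scaler0).
have [be' tri' mul'] := tables 1 0 Z (oner_neq0 _) Z0.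
exists V, B', [tuple 1 *: e1; e2 + 0 *: e3; Z *: e3]; split => //; right.
exists 1; first by right.
by move: mul'; rewrite Y0 !scale0r add0r.
Qed.
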